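(* Let $\sigma<-2$ and let $F(a,b)=\operatorname{sgn}(\sigma)\,K^{\sigma/2}=-(ab)^{\sigma/2}$ for $a,b>0$, where $K=ab$. Then there exists no maximum-principle function (MPF) for the normal velocity $F$.
   Context: Notation: $\mathbb{R}^2_+=(0,\infty)^2$; subscripts $a,b$ denote partial derivatives. Normal velocity: a symmetric function $F\in C^2(\mathbb{R}^2_+)$, homogeneous of some degree $\sigma\in\mathbb{R}\setminus\{0\}$, with $F_a,F_b>0$ for all $a,b>0$. It is contracting if $F>0$ everywhere on $\mathbb{R}^2_+$ and expanding if $F<0$ everywhere on $\mathbb{R}^2_+$. Maximum-principle function (MPF) for a normal velocity $F$: a symmetric function $w\in C^2(\mathbb{R}^2_+)$, homogeneous of some degree $\chi\in\mathbb{R}\setminus\{0\}$, such that, with $\alpha=-w_a/w_b$ and $\alpha_a=\partial\alpha/\partial a$ (defined for $a\ne b$): (1) $w>0$ whenever $a\neq b$, and $w=0$ whenever $a=b$. (2) $\chi>0$ if $F$ is contracting, $\chi<0$ if $F$ is expanding. (3) $w_a<0$ for all $0<a<b$, and $w_a>0$ for all $0<b<a$. (4) For all $a,b>0$ (for $E_w,G_w$: $a\neq b$) one has $C_w(a,b)\le0$, $E_w(a,b)\le0$, $G_w(a,b)\le 0$, where $$C_w=w_a\,a\big((F_aa^2+F_bb^2)+(F-F_aa-F_bb)a\big)+w_b\,b\big((F_aa^2+F_bb^2)+(F-F_aa-F_bb)b\big),$$ $$E_w=w_a(F_{aa}+2F_{ab}\alpha+F_{bb}\alpha^2)-F_a(w_{aa}+2w_{ab}\alpha+w_{bb}\alpha^2)+2\,\frac{w_bF_a-w_aF_b}{a-b}\,\alpha^2,$$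 $$G_w=\frac1{\alpha^2}\Big(w_b(F_{aa}+2F_{ab}\alpha+F_{bb}\alpha^2)-F_b(w_{aa}+2w_{ab}\alpha+w_{bb}\alpha^2)+2\,\frac{w_bF_a-w_aF_b}{a-b}\Big).$$ (5) There are constants $c>0$, $d\in\mathbb{R}$ such that, evaluating $\alpha$ and $\alpha_a$ at $(a,b)=(\rho,1)$ with $0<\rho<1$: if $F$ is contracting, then either $\alpha=c$ and $\alpha_a=0$ for all sufficiently small $\rho$, or, as $\rho\to0$, $\alpha=\frac c\rho+o(\rho^{-1})$ and $\alpha_a=-\frac c{\rho^2}+o(\rho^{-1})$; if $F$ is expanding, then, as $\rho\to0$, either $\alpha=\frac c\rho+o(\rho^{-1})$ and $\alpha_a=-\frac c{\rho^2}+o(\rho^{-1})$, or $\alpha=\frac{c+d\rho}{\rho^2}+o(\rho^{-1})$ and $\alpha_a=-\frac{2c+d\rho}{\rho^3}+o(\rho^{-1})$. *)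

(* Defs.v *)
From Stdlib Require Import Reals Lra.
From Coquelicot Require Import Coquelicot.
Open Scope R_scope.

(* A function on the quadrant (0,oo)^2 is represented by a total function
   R -> R -> R of which only the values at positive arguments matter: every
   condition below is imposed at points of the quadrant only, and the quadrant
   is open, so partial derivatives there do not see the values outside. *)

Definition d_a (f : R -> R -> R) : R -> R -> R := partial_derive 1 0 f.
Definition d_b (f : R -> R -> R) : R -> R -> R := partial_derive 0 1 f.
Definition d_aa (f : R -> R -> R) : R -> R -> R := d_a (d_a f).
Definition d_ab (f : R -> R -> R) : R -> R -> R := d_b (d_a f).
Definition d_bb (f : R -> R -> R) : R -> R -> R := d_b (d_b f).

(* [ex_diff_n f 2 a b] says that f and its partial derivatives up to order 2
   exist and are continuous at (a, b), as functions of two variables. *)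
Definition C2_quadrant (f : R -> R -> R) : Prop :=
  forall a b : R, 0 < a -> 0 < b -> ex_diff_n f 2 a b.

Definition symmetric_quadrant (f : R -> R -> R) : Prop :=
  forall a b : R, 0 < a -> 0 < b -> f a b = f b a.

Definition homogeneous_quadrant (k : R) (f : R -> R -> R) : Prop :=
  forall t a b : R, 0 < t -> 0 < a -> 0 < b ->
    f (t * a) (t * b) = Rpower t k * f a b.

Record normal_velocity (F : R -> R -> R) : Prop := {
  velocity_C2 : C2_quadrant F;
  velocity_symmetric : symmetric_quadrant F;
  velocity_homogeneous : exists sigma : R,
    sigma <> 0 /\ homogeneous_quadrant sigma F;
  velocity_monotone : forall a b : R, 0 < a -> 0 < b ->
    0 < d_a F a b /\ 0 < d_b F a b
}.

Definition contracting (F : R -> R -> R) : Prop :=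
  forall a b : R, 0 < a -> 0 < b -> 0 < F a b.

Definition expanding (F : R -> R -> R) : Prop :=
  forall a b : R, 0 < a -> 0 < b -> F a b < 0.

Definition alpha (w : R -> R -> R) (a b : R) : R := - (d_a w a b / d_b w a b).

Definition C_term (F w : R -> R -> R) (a b : R) : R :=
  let Fa := d_a F a b in
  let Fb := d_b F a b in
  d_a w a b * a
    * ((Fa * a ^ 2 + Fb * b ^ 2) + (F a b - Fa * a - Fb * b) * a)
  + d_b w a b * b
    * ((Fa * a ^ 2 + Fb * b ^ 2) + (F a b - Fa * a - Fb * b) * b).

(* The quadratic form of the Hessian of f at (a, b) in the direction (1, x). *)
Definition hessian_form (f : R -> R -> R) (a b x : R) : R :=
  d_aa f a b + 2 * d_ab f a b * x + d_bb f a b * x ^ 2.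

Definition E_term (F w : R -> R -> R) (a b : R) : R :=
  let al := alpha w a b in
  d_a w a b * hessian_form F a b al - d_a F a b * hessian_form w a b al
  + 2 * ((d_b w a b * d_a F a b - d_a w a b * d_b F a b) / (a - b)) * al ^ 2.

Definition G_term (F w : R -> R -> R) (a b : R) : R :=
  let al := alpha w a b in
  / al ^ 2 *
  (d_b w a b * hessian_form F a b al - d_b F a b * hessian_form w a b al
   + 2 * ((d_b w a b * d_a F a b - d_a w a b * d_b F a b) / (a - b))).

(* f rho = g rho + o (1 / rho) as rho -> 0, rho > 0. *)
Definition equal_up_to_o_inv (f g : R -> R) : Prop :=
  is_domin (at_right 0) (fun rho : R => / rho) (fun rho : R => f rho - g rho).

Definition alpha_eventually_constant (w : R -> R -> R) (c : R) : Prop :=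
  at_right 0 (fun rho : R =>
    alpha w rho 1 = c /\ d_a (alpha w) rho 1 = 0).

Definition alpha_simple_pole (w : R -> R -> R) (c : R) : Prop :=
  equal_up_to_o_inv (fun rho => alpha w rho 1) (fun rho => c / rho) /\
  equal_up_to_o_inv (fun rho => d_a (alpha w) rho 1)
                    (fun rho => - (c / rho ^ 2)).

Definition alpha_double_pole (w : R -> R -> R) (c d : R) : Prop :=
  equal_up_to_o_inv (fun rho => alpha w rho 1)
                    (fun rho => (c + d * rho) / rho ^ 2) /\
  equal_up_to_o_inv (fun rho => d_a (alpha w) rho 1)
                    (fun rho => - ((2 * c + d * rho) / rho ^ 3)).

(* [MPF F w]: w is a maximum-principle function for the normal velocity F. *)
Record MPF (F w : R -> R -> R) : Prop := {
  MPF_C2 : C2_quadrant w;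
  MPF_symmetric : symmetric_quadrant w;
  MPF_homogeneous : exists chi : R,
    chi <> 0 /\ homogeneous_quadrant chi w /\
    (contracting F -> 0 < chi) /\ (expanding F -> chi < 0);
  MPF_pos : forall a b : R, 0 < a -> 0 < b -> a <> b -> 0 < w a b;
  MPF_diag : forall a : R, 0 < a -> w a a = 0;
  MPF_decreasing : forall a b : R, 0 < a -> a < b -> d_a w a b < 0;
  MPF_increasing : forall a b : R, 0 < b -> b < a -> 0 < d_a w a b;
  MPF_C : forall a b : R, 0 < a -> 0 < b -> C_term F w a b <= 0;
  MPF_E : forall a b : R, 0 < a -> 0 < b -> a <> b -> E_term F w a b <= 0;
  MPF_G : forall a b : R, 0 < a -> 0 < b -> a <> b -> G_term F w a b <= 0;
  MPF_asymptotics : exists c d : R, 0 < c /\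
    (contracting F -> alpha_eventually_constant w c \/ alpha_simple_pole w c) /\
    (expanding F -> alpha_simple_pole w c \/ alpha_double_pole w c d)
}.

(* F = sgn(sigma) K^(sigma/2), with K = a b. *)
Definition gauss_velocity (sigma a b : R) : R :=
  sign sigma * Rpower (a * b) (sigma / 2).

Lemma gauss_velocity_neg_degree (sigma : R) :
  sigma < 0 ->
  forall a b : R, gauss_velocity sigma a b = - Rpower (a * b) (sigma / 2).
Proof.
intros h a b. unfold gauss_velocity. rewrite (sign_eq_m1 _ h). ring.
Qed.

(* [gauss_velocity sigma] is a normal velocity; it is studied through the
   monomials c a^p b^q, a family closed under partial derivatives. *)

Definition monomial (c p q a b : R) : R := c * (Rpower a p * Rpower b q).

Lemma is_derive_monomial_a (c p q a b : R) :
  0 < a ->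
  is_derive (fun x => monomial c p q x b) a (monomial (c * p) (p - 1) q a b).
Proof.
intros ha. apply is_derive_Reals.
replace (monomial (c * p) (p - 1) q a b)
  with (c * Rpower b q * (p * Rpower a (p - 1))) by (unfold monomial; ring).
apply (derivable_pt_lim_ext (fun x => c * Rpower b q * Rpower x p)).
{ intros t. unfold monomial. ring. }
apply (derivable_pt_lim_scal (fun x => Rpower x p)).
now apply derivable_pt_lim_power.
Qed.

Lemma is_derive_monomial_b (c p q a b : R) :
  0 < b ->
  is_derive (fun x => monomial c p q a x) b (monomial (c * q) p (q - 1) a b).
Proof.
intros hb.
replace (monomial (c * q) p (q - 1) a b) with (monomial (c * q) (q - 1) p b a)
  by (unfold monomial; ring).
apply (is_derive_ext (fun x => monomial c q p x a)).
{ intros t. unfold monomial. f_equal. apply Rmult_comm. }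
now apply is_derive_monomial_a.
Qed.

Lemma locally_2d_quadrant (P : R -> R -> Prop) (a b : R) :
  0 < a -> 0 < b -> (forall u v, 0 < u -> 0 < v -> P u v) -> locally_2d P a b.
Proof.
intros ha hb H. exists (mkposreal _ (Rmin_pos _ _ ha hb)). simpl.
intros u v hu hv. apply H.
- apply Rabs_def2 in hu. pose proof (Rmin_l a b). lra.
- apply Rabs_def2 in hv. pose proof (Rmin_r a b). lra.
Qed.

Lemma continuity_2d_pt_monomial (c p q a b : R) :
  0 < a -> 0 < b -> continuity_2d_pt (monomial c p q) a b.
Proof.
assert (H : forall r x, 0 < x -> continuity_pt (fun y => Rpower y r) x).
{ intros r x hx. apply derivable_continuous_pt. eexists.
  now apply derivable_pt_lim_power. }
intros ha hb. unfold monomial.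
apply continuity_2d_pt_mult; [apply continuity_2d_pt_const|].
apply continuity_2d_pt_mult.
- apply (continuity_1d_2d_pt_comp (fun y => Rpower y p) (fun x _ => x)).
  + now apply H.
  + apply continuity_2d_pt_id1.
- apply (continuity_1d_2d_pt_comp (fun y => Rpower y q) (fun _ y => y)).
  + now apply H.
  + apply continuity_2d_pt_id2.
Qed.

Lemma ex_diff_n_monomial (n : nat) (c p q a b : R) :
  0 < a -> 0 < b -> ex_diff_n (monomial c p q) n a b.
Proof.
revert c p q. induction n as [|n IH]; intros c p q ha hb; simpl;
  (split; [now apply continuity_2d_pt_monomial|]); [exact I|].
split; [eexists; now apply is_derive_monomial_a|].
split; [eexists; now apply is_derive_monomial_b|].
split.
- apply (ex_diff_n_ext_loc (monomial (c * p) (p - 1) q)); [|now apply IH].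
  apply locally_2d_quadrant; trivial. intros u v hu _.
  symmetry. apply is_derive_unique. now apply is_derive_monomial_a.
- apply (ex_diff_n_ext_loc (monomial (c * q) p (q - 1))); [|now apply IH].
  apply locally_2d_quadrant; trivial. intros u v _ hv.
  symmetry. apply is_derive_unique. now apply is_derive_monomial_b.
Qed.

Lemma gauss_velocity_monomial (sigma a b : R) :
  0 < a -> 0 < b ->
  gauss_velocity sigma a b
  = monomial (sign sigma) (sigma / 2) (sigma / 2) a b.
Proof.
intros ha hb. unfold gauss_velocity, monomial.
now rewrite Rpower_mult_distr.
Qed.

Lemma gauss_velocity_normal (sigma : R) :
  sigma <> 0 -> normal_velocity (gauss_velocity sigma).
Proof.
intros hs.
assert (hsign : 0 < sign sigma * (sigma / 2)).
{ destruct (Rtotal_order sigma 0) as [h|[h|h]]; [|contradiction|].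
  - rewrite (sign_eq_m1 _ h). lra.
  - rewrite (sign_eq_1 _ h). lra. }
assert (hpos : forall p q a b,
  0 < monomial (sign sigma * (sigma / 2)) p q a b).
{ intros p q a b. unfold monomial.
  apply Rmult_lt_0_compat; [assumption|].
  apply Rmult_lt_0_compat; apply exp_pos. }
assert (hloc : forall x, 0 < x -> locally x (fun y => 0 < y)).
{ intros x hx. now apply (open_gt 0). }
split.
- intros a b ha hb.
  apply (ex_diff_n_ext_loc (monomial (sign sigma) (sigma / 2) (sigma / 2))).
  + apply locally_2d_quadrant; trivial. intros u v hu hv.
    symmetry. now apply gauss_velocity_monomial.
  + now apply ex_diff_n_monomial.
- intros a b _ _. unfold gauss_velocity. now rewrite Rmult_comm with (r1 := a).
- exists sigma. split; [assumption|]. intros t a b ht ha hb.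
  unfold gauss_velocity.
  replace (t * a * (t * b)) with (t * t * (a * b)) by ring.
  rewrite <- (Rpower_mult_distr (t * t) (a * b)) by now apply Rmult_lt_0_compat.
  rewrite <- (Rpower_mult_distr t t) by assumption.
  rewrite <- Rpower_plus. replace (sigma / 2 + sigma / 2) with sigma by field.
  ring.
- intros a b ha hb. split.
  + unfold d_a, partial_derive; simpl.
    rewrite (Derive_ext_loc _
      (fun x => monomial (sign sigma) (sigma / 2) (sigma / 2) x b)).
    * erewrite is_derive_unique by now apply is_derive_monomial_a. apply hpos.
    * apply (filter_imp (fun y => 0 < y)); [|now apply hloc].
      intros y hy. now apply gauss_velocity_monomial.
  + unfold d_b, partial_derive; simpl.
    rewrite (Derive_ext_loc _
      (fun x => monomial (sign sigma) (sigma / 2) (sigma / 2) a x)).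
    * erewrite is_derive_unique by now apply is_derive_monomial_b. apply hpos.
    * apply (filter_imp (fun y => 0 < y)); [|now apply hloc].
      intros y hy. now apply gauss_velocity_monomial.
Qed.

(* Main.v *)
Require Import Defs.
From Stdlib Require Import Reals Lra.
From Coquelicot Require Import Coquelicot.
Open Scope R_scope.

(* Only the gradient inequality E_w <= 0 and the behaviour of alpha near the
   boundary are needed.  Since alpha is homogeneous of degree 0, the second
   derivatives of w along its level sets can be written through alpha and
   alpha_a alone, so that at (rho, 1), after division by the positive factor
   w_b * (- s) * rho^s with s = sigma / 2 < -1, the inequality E_w <= 0 becomes
   e <= 0 with e depending only on rho, alpha and alpha_a.  As rho -> 0,
   rho^3 e tends to - c (1 + c) (s + (s + 1) c) if alpha has a simple pole, and
   rho^6 e tends to - (s + 1) c^3 if it has a double pole; both limits are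
   positive for s < -1 and c > 0. *)

(** * Partial derivatives of functions on the open quadrant *)

Lemma locally_pos (x : R) : 0 < x -> locally x (fun y => 0 < y).
Proof. intros hx. now apply (open_gt 0). Qed.

Lemma d_a_ext (f g : R -> R -> R) :
  (forall u v, 0 < u -> 0 < v -> f u v = g u v) ->
  forall a b, 0 < a -> 0 < b -> d_a f a b = d_a g a b.
Proof.
intros H a b ha hb. apply (Derive_ext_loc (fun x => f x b) (fun x => g x b)).
apply (filter_imp (fun y => 0 < y)); [|now apply locally_pos].
intros y hy. now apply H.
Qed.

Lemma d_b_ext (f g : R -> R -> R) :
  (forall u v, 0 < u -> 0 < v -> f u v = g u v) ->
  forall a b, 0 < a -> 0 < b -> d_b f a b = d_b g a b.
Proof.
intros H a b ha hb. apply (Derive_ext_loc (fun y => f a y) (fun y => g a y)).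
apply (filter_imp (fun y => 0 < y)); [|now apply locally_pos].
intros y hy. now apply H.
Qed.

Lemma d_b_symmetric (f : R -> R -> R) :
  symmetric_quadrant f ->
  forall a b, 0 < a -> 0 < b -> d_b f a b = d_a f b a.
Proof.
intros H a b ha hb. apply (Derive_ext_loc (fun y => f a y) (fun y => f y a)).
apply (filter_imp (fun y => 0 < y)); [|now apply locally_pos].
intros y hy. now apply H.
Qed.

Lemma C2_quadrant_ex_derive (f : R -> R -> R) (a b : R) :
  C2_quadrant f -> 0 < a -> 0 < b ->
  ex_derive (fun x => f x b) a /\ ex_derive (fun y => f a y) b.
Proof. intros H ha hb. destruct (H a b ha hb) as (_ & H1 & H2 & _). tauto. Qed.

Lemma C2_quadrant_ex_derive_d_a (f : R -> R -> R) (a b : R) :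
  C2_quadrant f -> 0 < a -> 0 < b ->
  ex_derive (fun x => d_a f x b) a /\ ex_derive (fun y => d_a f a y) b.
Proof.
intros H ha hb. destruct (H a b ha hb) as (_ & _ & _ & (_ & H1 & H2 & _) & _).
now split.
Qed.

Lemma C2_quadrant_ex_derive_d_b (f : R -> R -> R) (a b : R) :
  C2_quadrant f -> 0 < a -> 0 < b ->
  ex_derive (fun x => d_b f x b) a /\ ex_derive (fun y => d_b f a y) b.
Proof.
intros H ha hb. destruct (H a b ha hb) as (_ & _ & _ & _ & (_ & H1 & H2 & _)).
now split.
Qed.

Lemma C2_quadrant_Schwarz (f : R -> R -> R) (a b : R) :
  C2_quadrant f -> 0 < a -> 0 < b -> d_a (d_b f) a b = d_ab f a b.
Proof.
intros H ha hb. apply (Schwarz f a b).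
- apply locally_2d_quadrant; trivial. intros u v hu hv.
  destruct (C2_quadrant_ex_derive f u v H hu hv) as [H1 H2].
  destruct (C2_quadrant_ex_derive_d_a f u v H hu hv) as [_ H3].
  destruct (C2_quadrant_ex_derive_d_b f u v H hu hv) as [H4 _].
  repeat split; assumption.
- destruct (H a b ha hb) as (_ & _ & _ & _ & (_ & _ & _ & [H1 _] & _)).
  exact H1.
- destruct (H a b ha hb) as (_ & _ & _ & (_ & _ & _ & _ & [H1 _]) & _).
  exact H1.
Qed.

(** * Homogeneity, the slope [alpha] and the Hessian along level sets *)

Lemma d_a_homogeneous (k : R) (f : R -> R -> R) :
  C2_quadrant f -> homogeneous_quadrant k f ->
  forall t a b, 0 < t -> 0 < a -> 0 < b ->
    t * d_a f (t * a) (t * b) = Rpower t k * d_a f a b.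
Proof.
intros H2 H t a b ht ha hb.
assert (hta := Rmult_lt_0_compat _ _ ht ha).
assert (htb := Rmult_lt_0_compat _ _ ht hb).
(* Both sides of the homogeneity identity are differentiated in the first variable. The chain-rule
   factor [t] stays on the left, which avoids the exponent [k - 1]. *)
transitivity (Derive (fun x => f (t * x) (t * b)) a).
- rewrite (Derive_comp (fun y => f y (t * b)) (fun x => t * x)).
  + rewrite Derive_scal, Derive_id. unfold d_a, partial_derive. simpl. ring.
  + exact (proj1 (C2_quadrant_ex_derive f _ _ H2 hta htb)).
  + auto_derive. trivial.
- rewrite (Derive_ext_loc _ (fun x => Rpower t k * f x b)).
  + now rewrite Derive_scal.
  + apply (filter_imp (fun y => 0 < y)); [|now apply locally_pos].
    intros y hy. now apply H.
Qed.

Lemma d_b_homogeneous (k : R) (f : R -> R -> R) :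
  C2_quadrant f -> homogeneous_quadrant k f ->
  forall t a b, 0 < t -> 0 < a -> 0 < b ->
    t * d_b f (t * a) (t * b) = Rpower t k * d_b f a b.
Proof.
intros H2 H t a b ht ha hb.
assert (hta := Rmult_lt_0_compat _ _ ht ha).
assert (htb := Rmult_lt_0_compat _ _ ht hb).
transitivity (Derive (fun y => f (t * a) (t * y)) b).
- rewrite (Derive_comp (fun y => f (t * a) y) (fun x => t * x)).
  + rewrite Derive_scal, Derive_id. unfold d_b, partial_derive. simpl. ring.
  + exact (proj2 (C2_quadrant_ex_derive f _ _ H2 hta htb)).
  + auto_derive. trivial.
- rewrite (Derive_ext_loc _ (fun y => Rpower t k * f a y)).
  + now rewrite Derive_scal.
  + apply (filter_imp (fun y => 0 < y)); [|now apply locally_pos].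
    intros y hy. now apply H.
Qed.

Lemma alpha_homogeneous (k : R) (w : R -> R -> R) :
  C2_quadrant w -> homogeneous_quadrant k w ->
  forall t a b, 0 < t -> 0 < a -> 0 < b ->
    alpha w (t * a) (t * b) = alpha w a b.
Proof.
intros H2 H t a b ht ha hb.
assert (hk : 0 < Rpower t k / t)
  by (apply Rdiv_lt_0_compat; [apply exp_pos|assumption]).
unfold alpha.
replace (d_a w (t * a) (t * b)) with (Rpower t k / t * d_a w a b).
2:{ apply (Rmult_eq_reg_l t); [|lra].
  rewrite (d_a_homogeneous k w) by assumption. field. lra. }
replace (d_b w (t * a) (t * b)) with (Rpower t k / t * d_b w a b).
2:{ apply (Rmult_eq_reg_l t); [|lra].
  rewrite (d_b_homogeneous k w) by assumption. field. lra. }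
(* The inverse of a product splits even where [d_b w a b] vanishes, since [/ 0 = 0]; [field] would
   ask for a nonzero denominator. *)
unfold Rdiv at 1. rewrite Rinv_mult. unfold Rdiv at 3.
generalize (Rpower t k / t) hk. intros r hr.
replace (r * d_a w a b * (/ r * / d_b w a b))
  with (r * / r * (d_a w a b * / d_b w a b)) by ring.
rewrite Rinv_r by lra. ring.
Qed.

(** Multiplying the quotient rule by [g x] leaves [f x / g x], which is [- alpha] in the
    application, in place of a squared denominator. *)
Lemma Derive_alpha_quotient (f g : R -> R) (x : R) :
  ex_derive f x -> ex_derive g x -> g x <> 0 ->
  ex_derive (fun y => - (f y / g y)) x /\
  Derive (fun y => - (f y / g y)) x * g x
  = - Derive f x + f x / g x * Derive g x.
Proof.
intros hf hg h0. split.
- apply (ex_derive_opp (fun y => f y / g y)). now apply ex_derive_div.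
- rewrite Derive_opp, Derive_div by assumption. now field.
Qed.

(** Differentiating [alpha = - w_a / w_b] in each variable expresses [w_aa] and [w_ab] through
    [w_bb], [alpha] and its derivatives. Euler's relation then eliminates [alpha_b], and [w_bb]
    cancels in the quadratic form. *)
Lemma hessian_form_alpha (k : R) (w : R -> R -> R) (a b : R) :
  C2_quadrant w -> homogeneous_quadrant k w ->
  0 < a -> 0 < b -> d_b w a b <> 0 ->
  hessian_form w a b (alpha w a b)
  = - d_b w a b * d_a (alpha w) a b * (1 - a / b * alpha w a b).
Proof.
intros H2 H ha hb h0.
destruct (C2_quadrant_ex_derive_d_a w a b H2 ha hb) as [Haa Hab].
destruct (C2_quadrant_ex_derive_d_b w a b H2 ha hb) as [Hba Hbb].
destruct (Derive_alpha_quotient _ _ _ Haa Hba h0) as [Hex Ha].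
destruct (Derive_alpha_quotient _ _ _ Hab Hbb h0) as [_ Hb].
change (d_a (alpha w) a b * d_b w a b
  = - d_aa w a b + d_a w a b / d_b w a b * d_a (d_b w) a b) in Ha.
change (d_b (alpha w) a b * d_b w a b
  = - d_ab w a b + d_a w a b / d_b w a b * d_bb w a b) in Hb.
rewrite C2_quadrant_Schwarz in Ha by assumption.
(* Since [alpha] is constant on rays, [alpha w a y] equals [alpha w (b / y * a) b], so the
   derivative in [y] reduces to [alpha_a] by the chain rule. *)
assert (Euler : d_b (alpha w) a b = - (a / b) * d_a (alpha w) a b).
{ transitivity (Derive (fun y => alpha w (b / y * a) b) b).
  - apply (Derive_ext_loc (fun y => alpha w a y)).
    apply (filter_imp (fun y => 0 < y)); [|now apply locally_pos].
    intros y hy. replace b with (b / y * y) at 2 by (field; lra).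
    symmetry. apply (alpha_homogeneous k); trivial.
    now apply Rdiv_lt_0_compat.
  - assert (e : b / b * a = a) by (field; lra).
    rewrite (Derive_comp (fun x => alpha w x b) (fun y => b / y * a)).
    + rewrite e. fold (d_a (alpha w) a b). f_equal.
      apply is_derive_unique. auto_derive; [lra|]. field. lra.
    + rewrite e. exact Hex.
    + auto_derive. lra. }
rewrite Euler in Hb.
unfold hessian_form.
set (al := alpha w a b) in *.
assert (e : d_a w a b / d_b w a b = - al) by (unfold al, alpha; ring).
rewrite e in Ha, Hb.
replace (d_aa w a b)
  with (- al * d_ab w a b - d_a (alpha w) a b * d_b w a b) by lra.
replace (d_ab w a b)
  with (- al * d_bb w a b + a / b * d_a (alpha w) a b * d_b w a b) by lra.
ring.
Qed.

(** * Derivatives of the velocity and the form of [E_term] at [(rho, 1)] *)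

Lemma d_a_monomial (c p q a b : R) :
  0 < a -> d_a (monomial c p q) a b = monomial (c * p) (p - 1) q a b.
Proof. intros ha. apply is_derive_unique. now apply is_derive_monomial_a. Qed.

Lemma d_b_monomial (c p q a b : R) :
  0 < b -> d_b (monomial c p q) a b = monomial (c * q) p (q - 1) a b.
Proof. intros hb. apply is_derive_unique. now apply is_derive_monomial_b. Qed.

Lemma monomial_at_1 (c p q a : R) : monomial c p q a 1 = c * Rpower a p.
Proof.
unfold monomial. replace (Rpower 1 q) with 1; [ring|].
unfold Rpower. rewrite ln_1, Rmult_0_r. symmetry. apply exp_0.
Qed.

Lemma Rpower_pred (x p : R) : 0 < x -> Rpower x (p - 1) = Rpower x p / x.
Proof.
intros hx. unfold Rminus. rewrite Rpower_plus, Rpower_Ropp, Rpower_1 by lra.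
reflexivity.
Qed.

Section GaussVelocity.

Variable sigma : R.
Hypothesis hsigma : sigma < 0.

Let s := sigma / 2.

Lemma gauss_velocity_neg_monomial (a b : R) :
  0 < a -> 0 < b -> gauss_velocity sigma a b = monomial (- 1) s s a b.
Proof.
intros ha hb. rewrite gauss_velocity_monomial by assumption.
now rewrite (sign_eq_m1 _ hsigma).
Qed.

Lemma d_a_gauss (a b : R) : 0 < a -> 0 < b ->
  d_a (gauss_velocity sigma) a b = monomial (- 1 * s) (s - 1) s a b.
Proof.
intros ha hb. rewrite (d_a_ext _ _ gauss_velocity_neg_monomial) by assumption.
now apply d_a_monomial.
Qed.

Lemma d_b_gauss (a b : R) : 0 < a -> 0 < b ->
  d_b (gauss_velocity sigma) a b = monomial (- 1 * s) s (s - 1) a b.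
Proof.
intros ha hb. rewrite (d_b_ext _ _ gauss_velocity_neg_monomial) by assumption.
now apply d_b_monomial.
Qed.

Lemma hessian_form_gauss (rho x : R) : 0 < rho ->
  hessian_form (gauss_velocity sigma) rho 1 x
  = - s * Rpower rho s
    * ((s - 1) / rho ^ 2 + 2 * s * x / rho + (s - 1) * x ^ 2).
Proof.
intros hr. assert (h1 := Rlt_0_1).
unfold hessian_form, d_aa, d_ab, d_bb.
rewrite (d_a_ext _ _ d_a_gauss), (d_b_ext _ _ d_a_gauss),
  (d_b_ext _ _ d_b_gauss) by assumption.
rewrite d_a_monomial, !d_b_monomial, !monomial_at_1, !Rpower_pred by assumption.
field. lra.
Qed.

(** With [w_a = - al * w_b] every term contains [w_b], and every first or second derivative of the
    velocity at [(rho, 1)] contains [- s * Rpower rho s]; the cofactor is rational in [rho], [al]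
    and [al']. *)
Lemma E_term_gauss (k : R) (w : R -> R -> R) (rho : R) :
  C2_quadrant w -> homogeneous_quadrant k w ->
  0 < rho < 1 -> 0 < d_b w rho 1 ->
  let al := alpha w rho 1 in
  let al' := d_a (alpha w) rho 1 in
  E_term (gauss_velocity sigma) w rho 1
  = d_b w rho 1 * (- s * Rpower rho s)
    * (- al * ((s - 1) / rho ^ 2 + 2 * s * al / rho + (s - 1) * al ^ 2)
       + al' * (1 - rho * al) / rho
       - 2 * (/ rho + al) * al ^ 2 / (1 - rho)).
Proof.
intros H2 H hr h0 al al'. assert (h1 := Rlt_0_1).
unfold E_term. fold al.
replace (hessian_form w rho 1 al)
  with (- d_b w rho 1 * al' * (1 - rho / 1 * al))
  by (symmetry; apply (hessian_form_alpha k); trivial; lra).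
rewrite hessian_form_gauss by lra.
rewrite d_a_gauss, d_b_gauss, !monomial_at_1, !Rpower_pred by lra.
replace (d_a w rho 1) with (- al * d_b w rho 1)
  by (unfold al, alpha; field; lra).
field. lra.
Qed.

Lemma E_term_gauss_nonpos (w : R -> R -> R) (rho : R) :
  MPF (gauss_velocity sigma) w -> 0 < rho < 1 ->
  let al := alpha w rho 1 in
  let al' := d_a (alpha w) rho 1 in
  - al * ((s - 1) / rho ^ 2 + 2 * s * al / rho + (s - 1) * al ^ 2)
  + al' * (1 - rho * al) / rho
  - 2 * (/ rho + al) * al ^ 2 / (1 - rho) <= 0.
Proof.
intros M hr al al'.
destruct (MPF_homogeneous _ _ M) as (k & _ & Hk & _).
assert (hb : 0 < d_b w rho 1).
(* By symmetry [w_b] at [(rho, 1)] is [w_a] at [(1, rho)], positive because [rho < 1]. *)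
{ rewrite (d_b_symmetric w (MPF_symmetric _ _ M)) by lra.
  apply (MPF_increasing _ _ M); lra. }
assert (HE := MPF_E _ _ M rho 1 ltac:(lra) ltac:(lra) ltac:(lra)).
rewrite (E_term_gauss k) in HE; trivial; [|exact (MPF_C2 _ _ M)].
fold al al' in HE.
assert (hP : 0 < d_b w rho 1 * (- s * Rpower rho s)).
{ apply Rmult_lt_0_compat; [assumption|].
  apply Rmult_lt_0_compat; [unfold s; lra|apply exp_pos]. }
apply (Rmult_le_reg_l _ _ _ hP). now rewrite Rmult_0_r.
Qed.

End GaussVelocity.

(** * Limits as [rho] tends to 0 from the right *)

Lemma at_right_0_unit : at_right 0 (fun rho => 0 < rho < 1).
Proof.
exists (mkposreal 1 Rlt_0_1). intros y hy hy0. split; [assumption|].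
apply Rabs_def2 in hy. unfold minus, plus, opp in hy. simpl in hy. lra.
Qed.

Section Limits.

Context {T : Type} (F : (T -> Prop) -> Prop) {FF : Filter F}.

Lemma filterlim_Rplus (f g : T -> R) (x y : R) :
  filterlim f F (locally x) -> filterlim g F (locally y) ->
  filterlim (fun t => f t + g t) F (locally (x + y)).
Proof.
intros hf hg. eapply filterlim_comp_2; [exact hf|exact hg|].
apply (@filterlim_plus R_AbsRing R_NormedModule).
Qed.

Lemma filterlim_Rmult (f g : T -> R) (x y : R) :
  filterlim f F (locally x) -> filterlim g F (locally y) ->
  filterlim (fun t => f t * g t) F (locally (x * y)).
Proof.
intros hf hg. eapply filterlim_comp_2; [exact hf|exact hg|].
apply (@filterlim_mult R_AbsRing).
Qed.

End Limits.

(** The exponent [S n] supplies at least one power of [rho], which absorbs the error [o(1 / rho)]: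
    the scaled error is at most [rho ^ n] times an arbitrarily small constant. *)
Lemma equal_up_to_o_inv_lim (n : nat) (f g : R -> R) (l : R) :
  equal_up_to_o_inv f g ->
  filterlim (fun rho => rho ^ S n * g rho) (at_right 0) (locally l) ->
  filterlim (fun rho => rho ^ S n * f rho) (at_right 0) (locally l).
Proof.
intros hfg hg.
apply (filterlim_ext
  (fun rho => rho ^ S n * (f rho - g rho) + rho ^ S n * g rho)).
{ intros x. ring. }
rewrite <- (Rplus_0_l l).
apply filterlim_Rplus; [apply at_right_proper_filter| |assumption].
apply filterlim_locally. intros eps.
assert (he : 0 < eps / 2) by (destruct eps; simpl; lra).
generalize (filter_and _ _ at_right_0_unit (hfg (mkposreal _ he))).
apply filter_imp. intros x [hx H]. simpl in H.
unfold norm in H. simpl in H. unfold abs in H. simpl in H.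
rewrite (Rabs_pos_eq (/ x)) in H
  by (apply Rlt_le, Rinv_0_lt_compat; lra).
change (Rabs (x ^ S n * (f x - g x) - 0) < eps).
rewrite Rminus_0_r, Rabs_mult, Rabs_pos_eq by (apply pow_le; lra).
assert (hp : x ^ n <= 1) by (rewrite <- (pow1 n); apply pow_incr; lra).
assert (hp0 : 0 <= x ^ n) by (apply pow_le; lra).
apply Rle_lt_trans with (x ^ S n * (eps / 2 * / x)).
{ apply Rmult_le_compat_l; [apply pow_le; lra|exact H]. }
replace (x ^ S n * (eps / 2 * / x)) with (x ^ n * (eps / 2))
  by (simpl; field; lra).
nra.
Qed.

(** Only sums and products are decomposed, and limits are matched as written. Hence the polynomials
    below use [+ - 1 *] for subtraction and products for squares, with their limits left
    unsimplified. *)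
Ltac poly_lim :=
  repeat (first
    [ eassumption
    | apply filterlim_const
    | apply filterlim_Rplus; [apply at_right_proper_filter| |]
    | apply filterlim_Rmult; [apply at_right_proper_filter| |] ]).

Lemma filterlim_at_right_0_id :
  filterlim (fun rho : R => rho) (at_right 0) (locally 0).
Proof.
apply filterlim_filter_le_1 with (2 := filterlim_id _ (locally 0)).
apply filter_le_within.
Qed.

Lemma at_right_0_lim_nonpos (f : R -> R) (l : R) :
  filterlim f (at_right 0) (locally l) -> at_right 0 (fun x => f x <= 0) ->
  l <= 0.
Proof.
intros hf h.
apply (@filterlim_le R (at_right 0) _ f (fun _ => 0) (Finite l) (Finite 0)).
- exact h.
- exact hf.
- apply filterlim_const.
Qed.

(** * Exclusion of the two boundary behaviours of [alpha] *)

Lemma gauss_no_simple_pole (sigma c : R) (w : R -> R -> R) :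
  sigma < -2 -> 0 < c -> MPF (gauss_velocity sigma) w ->
  ~ alpha_simple_pole w c.
Proof.
intros hs hc M [H0 H1].
set (s := sigma / 2).
apply (equal_up_to_o_inv_lim 0 _ _ c) in H0.
2:{ apply (filterlim_ext_loc (fun _ => c)); [|apply filterlim_const].
  generalize at_right_0_unit. apply filter_imp.
  intros x hx. field. lra. }
apply (equal_up_to_o_inv_lim 1 _ _ (- c)) in H1.
2:{ apply (filterlim_ext_loc (fun _ => - c)); [|apply filterlim_const].
  generalize at_right_0_unit. apply filter_imp.
  intros x hx. field. lra. }
set (u := fun rho => rho ^ 1 * alpha w rho 1) in H0.
set (v := fun rho => rho ^ 2 * d_a (alpha w) rho 1) in H1.
assert (Hid := filterlim_at_right_0_id).
assert (L : filterlim (fun rho =>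
   (- 1 * u rho * ((s - 1) + 2 * s * u rho + (s - 1) * (u rho * u rho))
    + v rho * (1 + - 1 * u rho)) * (1 + - 1 * rho)
   + - 2 * (1 + u rho) * (u rho * u rho)) (at_right 0)
  (locally
   ((- 1 * c * ((s - 1) + 2 * s * c + (s - 1) * (c * c))
    + - c * (1 + - 1 * c)) * (1 + - 1 * 0)
   + - 2 * (1 + c) * (c * c)))) by poly_lim.
apply at_right_0_lim_nonpos in L.
- assert (hs' : s < -1) by (unfold s; lra).
  (* This product is the limit in [L] in factored form; [- s] and [- (s + 1)] are both positive. *)
  assert (0 < c * (1 + c) * (- s - (s + 1) * c)).
  { repeat apply Rmult_lt_0_compat; nra. }
  nra.
- generalize at_right_0_unit. apply filter_imp. intros x hx.
  assert (HE := E_term_gauss_nonpos sigma ltac:(lra) w x M hx).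
  simpl in HE. fold s in HE.
  (* [x ^ 3] cancels the pole of order three, and [1 - x] clears the denominator that comes from
     [a - b]. *)
  apply (Rmult_le_compat_l (x ^ 3 * (1 - x))) in HE.
  2:{ apply Rmult_le_pos; [apply pow_le|]; lra. }
  rewrite Rmult_0_r in HE. eapply Rle_trans; [|exact HE].
  apply Req_le. unfold u, v. field. lra.
Qed.

Lemma gauss_no_double_pole (sigma c d : R) (w : R -> R -> R) :
  sigma < -2 -> 0 < c -> MPF (gauss_velocity sigma) w ->
  ~ alpha_double_pole w c d.
Proof.
intros hs hc M [H0 H1].
set (s := sigma / 2).
assert (Hid := filterlim_at_right_0_id).
apply (equal_up_to_o_inv_lim 1 _ _ (c + d * 0)) in H0.
2:{ apply (filterlim_ext_loc (fun rho => c + d * rho)); [|poly_lim].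
  generalize at_right_0_unit. apply filter_imp.
  intros x hx. field. lra. }
apply (equal_up_to_o_inv_lim 2 _ _ (- 1 * (2 * c + d * 0))) in H1.
2:{ apply (filterlim_ext_loc (fun rho => - 1 * (2 * c + d * rho))); [|poly_lim].
  generalize at_right_0_unit. apply filter_imp.
  intros x hx. field. lra. }
set (u := fun rho => rho ^ 2 * alpha w rho 1) in H0.
set (v := fun rho => rho ^ 3 * d_a (alpha w) rho 1) in H1.
replace (c + d * 0) with c in H0 by ring.
replace (- 1 * (2 * c + d * 0)) with (- 2 * c) in H1 by ring.
(* Scaled by [rho ^ 6], only the terms cubic in [alpha] survive; every other term keeps a factor
   [rho]. Their coefficients [- (s - 1)] and [- 2] add up to [- (s + 1)]. *)
assert (L : filterlim (fun rho =>
   (- 1 * u rho * ((s - 1) * (rho * rho) + 2 * s * u rho * rho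
                   + (s - 1) * (u rho * u rho))
    + v rho * rho * (rho + - 1 * u rho)) * (1 + - 1 * rho)
   + - 2 * (rho + u rho) * (u rho * u rho)) (at_right 0)
  (locally
   ((- 1 * c * ((s - 1) * (0 * 0) + 2 * s * c * 0 + (s - 1) * (c * c))
    + - 2 * c * 0 * (0 + - 1 * c)) * (1 + - 1 * 0)
   + - 2 * (0 + c) * (c * c)))) by poly_lim.
apply at_right_0_lim_nonpos in L.
- assert (hs' : s < -1) by (unfold s; lra).
  assert (0 < (- s - 1) * c * (c * c)).
  { repeat apply Rmult_lt_0_compat; lra. }
  nra.
- generalize at_right_0_unit. apply filter_imp. intros x hx.
  assert (HE := E_term_gauss_nonpos sigma ltac:(lra) w x M hx).
  simpl in HE. fold s in HE.
  apply (Rmult_le_compat_l (x ^ 6 * (1 - x))) in HE.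
  2:{ apply Rmult_le_pos; [apply pow_le|]; lra. }
  rewrite Rmult_0_r in HE. eapply Rle_trans; [|exact HE].
  apply Req_le. unfold u, v. field. lra.
Qed.

Theorem theorem7p1 (sigma : R) (hsigma : sigma < -2) :
  ~ exists w : R -> R -> R, MPF (gauss_velocity sigma) w.
Proof.
intros [w M].
destruct (MPF_asymptotics _ _ M) as (c & d & hc & _ & Hexp).
(* The first goal is the premise that the velocity is expanding; the other two are the alternatives
   for the pole of [alpha]. *)
destruct Hexp as [H|H].
- intros a b _ _. rewrite gauss_velocity_neg_degree by lra.
  apply Ropp_lt_gt_0_contravar, exp_pos.
- now apply (gauss_no_simple_pole sigma c w hsigma hc M).
- now apply (gauss_no_double_pole sigma c d w hsigma hc M).
Qed.
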